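(* For $r,s,q\in\mathbb{C}$ with $|q|<1$, define $$\phi(r,s,q)= \sum_{j=0}^{\infty}\frac{q^{(j^{2}+j)/2}r^{j}}{(q;q)_{j}(-sq;q)_{j}}.$$ Let $m$ and $n$ be positive integers and let $d$ be a rational number such that $dn$ is a positive integer and $dmn>1$. Then the following hold. (1) $$[1;\overline{d^{k-1}n^{k},m^{k}}\,]_{k=1}^{\infty}=\frac{\phi(d m,d,1/(d m n))}{\phi(1/n,d,1/(d m n))}.$$ (2) If $n>2$ and $m>1$, then $$[0;\overline{1,d^{2k-2}n^{2k-1}-2,1,m^{2k-1}-1,d^{2k-1}n^{2k},m^{2k}-1}\,]_{k=1}^{\infty}=\frac{\phi(d m,d,-1/(d m n))}{\phi(-1/n,d,-1/(d m n))}.$$ (3) If $m>2$ and $n>1$, then $$[1;\overline{d^{2k-2}n^{2k-1}-1,1,m^{2k-1}-2,1,d^{2k-1}n^{2k}-1,m^{2k}}\,]_{k=1}^{\infty}=\frac{\phi(-d m,d,-1/(d m n))}{\phi(1/n,d,-1/(d m n))}.$$ (4) If $n>2$ and $m>1$, then $$[1;\overline{d^{2k-2}n^{2k-1},m^{2k-1}-1,1,d^{2k-1}n^{2k}-2,1,m^{2k}-1}\,]_{k=1}^{\infty}=\frac{\phi(-d m,-d,-1/(d m n))}{\phi(1/n,-d,-1/(d m n))}.$$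
   Context: For complex $x,q$: $(x;q)_0:=1$ and $(x;q)_j:=\prod_{i=0}^{j-1}(1-xq^{i})$ for $j\ge 1$. $[a_0;a_1,a_2,\ldots]$ denotes the (value of the) infinite regular continued fraction $a_0+\cfrac{1}{a_1+\cfrac{1}{a_2+\cdots}}$. The notation $[a_0;\overline{f_1(k),\ldots,f_r(k)}\,]_{k=1}^{\infty}$ means that after $a_0$ the partial quotients are $f_1(1),\ldots,f_r(1),f_1(2),\ldots,f_r(2),f_1(3),\ldots$, i.e. the blocks $f_1(k),\ldots,f_r(k)$ for $k=1,2,3,\ldots$ concatenated in order. *)

(* Defs.v *)
From HB Require Import structures.
From mathcomp Require Import all_boot all_order all_algebra.
From mathcomp Require Import all_classical all_reals all_analysis.
From mathcomp.real_closed Require Import complex.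

Set Implicit Arguments.
Unset Strict Implicit.
Unset Printing Implicit Defensive.

Import Order.TTheory GRing.Theory Num.Theory.
Import numFieldNormedType.Exports.
Local Open Scope classical_set_scope.
Local Open Scope ring_scope.

(* The complex numbers are R[i] for a realType R.  The concrete type R[i] does
   not inherit a topology, so limits are taken in its alias R[i]^o, whose
   topology is that of the modulus. *)

(* (x; q)_j *)
Definition qPoch (K : comPzRingType) (x q : K) (j : nat) : K :=
  \prod_(i < j) (1 - x * q ^+ i).

Definition phi_term (K : fieldType) (r s q : K) (j : nat) : K :=
  q ^+ ((j ^ 2 + j)./2)%N * r ^+ j / (qPoch q q j * qPoch (- s * q) q j).

(* phi is total; it is the sum of the series of the phi_term when `|q| < 1 and
   1 + s * q ^+ i != 0 for all i >= 1. *)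
Definition phi (R : realType) (r s q : R[i]) : R[i] :=
  limn (series (phi_term r s q) : nat -> R[i]^o).

(* The finite continued fraction [a 0; a 1, ..., a N]. *)
Fixpoint convergent (a : nat -> rat) (N : nat) : rat :=
  if N is N'.+1 then a 0%N + (convergent (fun i => a i.+1) N')^-1 else a 0%N.

(* Partial quotients have type rat since they are given by formulas in a
   rational d; regularity asks them to be integers, positive after a 0. *)
Definition regular_cf (a : nat -> rat) : Prop :=
  a 0%N \is a Num.int /\ forall i : nat, a i.+1 \is a Num.int /\ 0 < a i.+1.

(* [a 0; a 1, a 2, ...] is a regular continued fraction with value x. *)
Definition regular_cf_value (R : realType) (a : nat -> rat) (x : R[i]) : Prop :=
  regular_cf a /\
  (fun N : nat => ratr (convergent a N) : R[i]^o) @ \oo --> (x : R[i]^o).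

(* Partial quotients a0, then the blocks f 1, f 2, f 3, ... of length r. *)
Definition cf_blocks (a0 : rat) (r : nat) (f : nat -> r.-tuple rat) (i : nat)
    : rat :=
  if i is i'.+1 then nth 0 (f (i' %/ r).+1) (i' %% r) else a0.

(* Main.v *)
Require Import Defs.
From HB Require Import structures.
From mathcomp Require Import all_boot all_order all_algebra.
From mathcomp Require Import all_classical all_reals all_analysis.
From mathcomp.real_closed Require Import complex.
From mathcomp Require Import zify ring lra.

Set Implicit Arguments.
Unset Strict Implicit.
Unset Printing Implicit Defensive.

Import Order.TTheory GRing.Theory Num.Theory.
Import numFieldNormedType.Exports.
Local Open Scope classical_set_scope.
Local Open Scope ring_scope.

(** Put [H_k = phi (r q^k) (s q^k) q] and [L_k = phi (r q^(k+1)) (s q^k) q].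
    Comparing coefficients of the defining series gives Heine-type contiguous
    relations
      [H_k = L_k + r q^(k+1) / (1 + s q^(k+1)) * H_(k+1)],
      [(1 + s q^(k+1)) L_k = H_(k+1) + s q^(k+1) L_(k+1)]
    (lemmas [rphi_shift_r] and [rphi_shift_s]).  After multiplication by
    suitable weights, [H_k] and [L_k] become sequences [U_k] and [V_k] with
      [U_k = mu^k V_k + U_(k+1)]  and
      [V_k = d^k nu^(k+1) U_(k+1) + V_(k+1)],
    where [r = d mu], [s = d] and [q = 1 / (d mu nu)] (lemma [phi_tails]).
    Hence [U_0 / V_0 = phi r s q / phi (1/nu) s q] has formally the continued
    fraction [1; nu, mu, d nu^2, mu^2, d^2 nu^3, ...].  The four identities are
    the choices (mu, d, nu) = (m, d, n), (m, d, -n), (-m, d, n), (m, -d, n).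

    For the first choice this continued fraction is regular.  In each of the
    others, one of the two families of quotients, the [mu^k] or the
    [d^k nu^(k+1)], has alternating signs, and
      [a - 1/(x - 1/Y) = [a - 1; 1, x - 2, 1, Y - 1]]
    turns it into the regular one of the statement.  This is carried out on the
    tails: the new tails are explicit combinations of the [U_k] and [V_k], and
    their signs flip after each block of six quotients.

    It remains that a regular continued fraction is the ratio [X_0 / X_1] of any
    bounded solution, not identically zero, of [X_i = a_i X_(i+1) + X_(i+2)]
    (lemma [regular_cf_tails]): two steps of the expansion contract the error
    [X_0 - c_N X_1] by a factor 2.  Such a solution with [X_1 = 0] would have
    [X_0 = 0] and vanish altogether, so the denominator of the quotient of phi's
    is automatically nonzero.  Boundedness, and the fact that the [U_k] do not
    vanish identically, come from the majorant [|t_j| <= x^j / j!] for the terms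
    of phi (lemma [phi_term_le]), where [x] tends to 0 when [r] does.

    All parameters are real, so the analysis takes place in [R]; the values are
    transported to [R[i]] at the end (lemma [phi_cf_value]). *)

(** * Continued fractions and bounded solutions of their recurrence *)

Lemma int_gt0_ge1 (z : rat) : z \is a Num.int -> 0 < z -> 1 <= z.
Proof. by move=> zZ z0; rewrite -(gtr0_norm z0) norm_intr_ge1 ?gt_eqF. Qed.

Lemma convergent_ge1 (a : nat -> rat) (N : nat) :
  (forall i, 1 <= a i) -> 1 <= convergent a N.
Proof.
elim: N a => [|N IHN] a a1 //=.
rewrite (le_trans (a1 0%N)) // lerDl invr_ge0 (le_trans ler01) //.
exact: IHN.
Qed.

(** Since [X_0 - c_N X_1 = (X_2 - c' X_3) / (a_1 c' + 1)], where [c'] is the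
    convergent of the tail starting at [a_2], and [a_1 c' + 1 >= 2], the error is
    halved every two steps. *)
Lemma convergent_error (R : realType) (a : nat -> rat) (X : nat -> R) (B : R)
    (N : nat) :
    (forall i, 1 <= a i.+1) ->
    (forall i, X i = ratr (a i) * X i.+1 + X i.+2) ->
    (forall i, `|X i| <= B) ->
  `|X 0%N - ratr (convergent a N) * X 1%N| * 2 ^+ N./2 <= B.
Proof.
move=> a1 XE XB.
have ratr1 (z : rat) : 1 <= z -> 1 <= ratr z :> R by rewrite -(ler_rat R) rmorph1.
have [n] := ubnP N; elim: n => // n IHn in N a X a1 XE XB *.
case: N => [_|[_|N]] /=.
- by rewrite expr0 mulr1 (XE 0%N) addrC addKr.
- rewrite expr0 mulr1 (XE 0%N) (XE 1%N) rmorphD fmorphV /=.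
  have y1 := ratr1 _ (a1 0%N); set y := ratr (a 1%N) in y1 *.
  have y0 : 0 < y by lra.
  have -> : ratr (a 0%N) * (y * X 2%N + X 3%N) + X 2%N
      - (ratr (a 0%N) + y^-1) * (y * X 2%N + X 3%N) = - (X 3%N / y).
    by field; rewrite gt_eqF.
  rewrite normrN normrM normfV (gtr0_norm y0) ler_pdivrMr //.
  by rewrite (le_trans (XB 3%N)) // ler_peMr // (le_trans _ (XB 0%N)).
rewrite !ltnS => Nn.
have := IHn N (fun i => a i.+2) (fun i => X i.+2) (fun i => a1 _)
  (fun i => XE _) (fun i => XB _) (ltnW Nn).
have := ratr1 _ (convergent_ge1 N (fun i => a1 i.+1)).
set c := convergent _ N => c1 cB.
rewrite rmorphD fmorphV rmorphD fmorphV /= -/c (XE 0%N) (XE 1%N).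
set w := ratr c in c1 cB *; set y := ratr (a 1%N).
have y1 : 1 <= y by exact: ratr1.
have w0 : 0 < w by lra.
have yw0 : 0 < y * w + 1 by nra.
have yw2 : 2 <= y * w + 1 by nra.
set x2 := X 2%N in cB *; set x3 := X 3%N in cB *.
have -> : ratr (a 0%N) * (y * x2 + x3) + x2
    - (ratr (a 0%N) + (y + w^-1)^-1) * (y * x2 + x3)
    = (x2 - w * x3) / (y * w + 1).
  by field; rewrite !gt_eqF //= mulrC.
rewrite normrM normfV (gtr0_norm yw0) exprS mulrCA mulrA.
apply: le_trans cB; rewrite ler_wpM2r ?exprn_ge0 // mulrA.
rewrite ler_pdivrMr // mulrC ler_wpM2l //.
Qed.

(** The boundedness of [X] selects, up to a factor, one solution of the
    recurrence, and it also forces [X 1 != 0]: otherwise the error estimate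
    gives [X 0 = 0], and a solution with two consecutive zeros is zero. *)
Lemma regular_cf_tails (R : realType) (a : nat -> rat) (X : nat -> R) (B : R) :
    regular_cf a ->
    (forall i, X i = ratr (a i) * X i.+1 + X i.+2) ->
    (forall i, `|X i| <= B) -> (exists i, X i != 0) ->
  (fun N => ratr (convergent a N) : R) @ \oo --> X 0%N / X 1%N.
Proof.
move=> [_ ai] XE XB [j Xj].
have a1 i : 1 <= a i.+1 by have [? ?] := ai i; apply: int_gt0_ge1.
have B0 : 0 <= B by apply: le_trans (XB 0%N).
have err N : `|X 0%N - ratr (convergent a N) * X 1%N| <= (B * 2) / N.+1%:R.
  rewrite ler_pdivlMr //.
  have := convergent_error N a1 XE XB; rewrite -(ler_pM2r (ltr0n _ 2)).
  apply: le_trans; rewrite -[leRHS]mulrA ler_wpM2l // -natrX -natrM ler_nat.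
  have : (N./2 < 2 ^ N./2)%N by apply: ltn_expl.
  by have := odd_double_half N; case: (odd N) => /=; lia.
have X1 : X 1%N != 0.
  apply/eqP => X1; suff X0 : X 0%N = 0.
    have X00 i : X i = 0 /\ X i.+1 = 0.
      elim: i => [//|i [Xi XSi]]; split=> //.
      by have := XE i; rewrite Xi XSi mulr0 add0r.
    by have [Xj0 _] := X00 j; rewrite Xj0 eqxx in Xj.
  apply/eqP; rewrite -normr_le0.
  have B2 : (fun N => (B * 2) * harmonic N : R) @ \oo --> (B * 2) * 0.
    by apply: cvgM; first exact: cvg_cst; exact: cvg_harmonic.
  rewrite mulr0 in B2; rewrite -(cvg_lim (@Rhausdorff R) B2).
  apply: limr_ge; first by apply/cvg_ex; exists 0.
  by apply: nearW => N; have := err N; rewrite X1 mulr0 subr0.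
have C0 : (fun N => (B * 2 / `|X 1%N|) * harmonic N : R) @ \oo -->
    (B * 2 / `|X 1%N|) * 0.
  by apply: cvgM; first exact: cvg_cst; exact: cvg_harmonic.
rewrite mulr0 in C0.
apply/cvgrPdist_le => e e0; move/cvgrPdist_le: C0 => /(_ e e0).
apply: filterS => N; rewrite sub0r normrN => /(le_trans (ler_norm _)).
apply: le_trans.
have -> : X 0%N / X 1%N - ratr (convergent a N) =
    (X 0%N - ratr (convergent a N) * X 1%N) / X 1%N by field.
rewrite normrM normfV [leRHS]mulrAC ler_pM2r ?invr_gt0 ?normr_gt0 //; exact: err.
Qed.

(** The previous lemma for tails indexed by block and place, [y k c] being the
    tail that starts at place [c] of block [k]; the two places after the end of
    a block are needed to state the recurrence inside the block. *)
Lemma cf_blocks_tails (R : realType) (a0 : rat) (r : nat)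
    (f : nat -> r.-tuple rat) (X0 : R) (y : nat -> nat -> R) (B : R) :
    (1 < r)%N ->
    a0 \is a Num.int ->
    (forall k, all (fun z => (z \is a Num.int) && (0 < z)) (f k.+1)) ->
    X0 = ratr a0 * y 0%N 0%N + y 0%N 1%N ->
    (forall k c, (c < r)%N ->
       y k c = ratr (nth 0 (f k.+1) c) * y k c.+1 + y k c.+2) ->
    (forall k, y k r = y k.+1 0%N) -> (forall k, y k r.+1 = y k.+1 1%N) ->
    `|X0| <= B -> (forall k c, (c < r)%N -> `|y k c| <= B) ->
    (exists k c, (c < r)%N /\ y k c != 0) ->
  regular_cf (cf_blocks a0 f) /\
  (fun N => ratr (convergent (cf_blocks a0 f) N) : R) @ \oo -->
    X0 / y 0%N 0%N.
Proof.
move=> r1 a0Z fpos X0E yE yr yrS X0B yB [k [c [cr ykc]]].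
have r0 : (0 < r)%N by apply: ltnW.
pose X i := if i is i'.+1 then y (i' %/ r)%N (i' %% r)%N else X0.
have X0' : X 0%N / X 1%N = X0 / y 0%N 0%N by rewrite /X div0n mod0n.
have reg : regular_cf (cf_blocks a0 f).
  split=> // i /=; have := allP (fpos (i %/ r)%N) _
    (mem_nth 0 (_ : (i %% r < size (f (i %/ r).+1))%N)).
  by rewrite size_tuple ltn_pmod // => /(_ isT) /andP[].
have yblock k' c' : (c' <= r.+1)%N ->
    y ((k' * r + c') %/ r)%N ((k' * r + c') %% r)%N = y k' c'.
  rewrite divnMDl // modnMDl leq_eqVlt ltnS leq_eqVlt => /or3P[/eqP->|/eqP->|lt].
  - rewrite -addn1 divnDl // divnn r0 modnDl divn_small // modn_small //.
    by rewrite !addn1 yrS.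
  - by rewrite divnn r0 modnn addn1 yr.
  - by rewrite divn_small // modn_small // addn0.
split=> //; rewrite -X0'; apply: (regular_cf_tails (B := B)) => //.
- case=> [|i]; first by rewrite /= !div0n !mod0n divn_small // modn_small.
  rewrite /X [cf_blocks _ _ _]/= (yE _ _ (ltn_pmod i r0)).
  have ir : (i %% r < r)%N by rewrite ltn_pmod.
  have iE : i = (i %/ r * r + i %% r)%N := divn_eq i r.
  have -> : i.+1 = (i %/ r * r + (i %% r).+1)%N by rewrite addnS -iE.
  by rewrite -addnS !yblock // leqW.
- by case=> [|i] //=; apply/yB/ltn_pmod.
- exists (k * r + c).+1 => /=.
  by rewrite divnMDl // modnMDl divn_small // modn_small // addn0.
Qed.

(** * The series phi over the reals *)

Definition rphi (R : realType) (r s q : R) : R := limn (series (phi_term r s q)).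

(** The terms of phi are dominated by those of the exponential series at this
    point; [delta] stands for a lower bound of all [`|1 + s * q ^+ i.+1|]. *)
Definition exp_majorant (R : realType) (q delta r : R) : R :=
  `|r| * `|q| / ((1 - `|q|) * delta).

Lemma qPochSr (K : comPzRingType) (x q : K) (j : nat) :
  qPoch x q j.+1 = qPoch x q j * (1 - x * q ^+ j).
Proof. by rewrite /qPoch big_ord_recr. Qed.

Lemma qPochSl (K : comPzRingType) (x q : K) (j : nat) :
  qPoch x q j.+1 = (1 - x) * qPoch (x * q) q j.
Proof.
rewrite /qPoch big_ord_recl expr0 mulr1; congr (_ * _).
by apply: eq_bigr => i _; rewrite -mulrA -exprS.
Qed.

Lemma triangularS (j : nat) :
  ((j.+1 ^ 2 + j.+1)./2 = (j ^ 2 + j)./2 + j.+1)%N.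
Proof.
have -> : (j.+1 ^ 2 + j.+1 = j ^ 2 + j + j.+1.*2)%N.
  by rewrite -!mulnn -addnn; ring.
by rewrite halfD doubleK odd_double andbF.
Qed.

Lemma phi_term0 (K : fieldType) (r s q : K) : phi_term r s q 0 = 1.
Proof.
rewrite /phi_term /qPoch !big_ord0 (_ : (0 ^ 2 + 0)./2 = 0)%N //.
by rewrite !expr0 !mulr1 divr1.
Qed.

Lemma phi_termS (K : fieldType) (r s q : K) (j : nat) :
  phi_term r s q j.+1 = phi_term r s q j *
    (q ^+ j.+1 * r / ((1 - q ^+ j.+1) * (1 + s * q ^+ j.+1))).
Proof.
rewrite /phi_term triangularS exprD [r ^+ _]exprSr !qPochSr.
rewrite !mulNr opprK -[s * q * _]mulrA -!exprS !invfM; ring.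
Qed.

(** With [a = 1 / (1 + h)] this is Bernoulli's inequality
    [i h <= (1 + h)^i - 1].  It makes the ratio of consecutive terms of phi
    of order [1 / i], as for the exponential series. *)
Lemma bernoulli_geometric (R : realFieldType) (a : R) (i : nat) : 0 <= a <= 1 ->
  i%:R * a ^+ i * (1 - a) <= a * (1 - a ^+ i).
Proof.
move=> /andP[a0 a1]; elim: i => [|i IHi].
  by rewrite expr0 subrr !mul0r mulr0.
have ai1 : a ^+ i <= 1 by rewrite exprn_ile1.
have ai0 : 0 <= a ^+ i by rewrite exprn_ge0.
have IHa := ler_wpM2l a0 IHi.
have P : 0 <= a * (1 - a) * (1 - a ^+ i) by rewrite !mulr_ge0 ?subr_ge0.
rewrite -natr1 exprS; move: (a ^+ i) (i%:R : R) => b c in ai1 ai0 IHa P *.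
nra.
Qed.

Lemma qpow_neq1 (R : realFieldType) (q : R) (i : nat) :
  `|q| < 1 -> 1 - q ^+ i.+1 != 0.
Proof.
move=> q1; rewrite subr_eq0 eq_sym; apply: contraTneq q1 => qi.
rewrite -leNgt -(@expr_ge1 _ i.+1) // -normrX qi normr1 //.
Qed.

Lemma phi_term_le (R : realType) (r s q delta : R) (j : nat) :
    `|q| < 1 -> 0 < delta -> (forall i, delta <= `|1 + s * q ^+ i.+1|) ->
  `|phi_term r s q j| <= exp_coeff (exp_majorant q delta r) j.
Proof.
move=> q1 delta0 sq; set x := exp_majorant q delta r.
elim: j => [|j IHj]; first by rewrite phi_term0 normr1 /exp_coeff /= expr0 divr1.
have -> : exp_coeff x j.+1 = exp_coeff x j * (x / j.+1%:R).
  by rewrite /exp_coeff /= factS natrM invfM exprSr; ring.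
rewrite phi_termS normrM ler_pM // normrM normfV !normrM normrX.
have d0 : 0 < `|1 + s * q ^+ j.+1| by apply: lt_le_trans (sq j).
have n0 : 0 < `|1 - q ^+ j.+1| by rewrite normr_gt0 qpow_neq1.
have qq0 : 0 < 1 - `|q| by rewrite subr_gt0.
have j0 : 0 < j.+1%:R :> R by rewrite ltr0n.
have nq : 1 - `|q| ^+ j.+1 <= `|1 - q ^+ j.+1|.
  by rewrite -normrX -{1}(normr1 R) lerB_dist.
have bern : j.+1%:R * `|q| ^+ j.+1 * (1 - `|q|) <= `|q| * `|1 - q ^+ j.+1|.
  apply: le_trans (bernoulli_geometric j.+1 _) _; first by rewrite normr_ge0 ltW.
  by rewrite ler_wpM2l.
rewrite ler_pdivrMr ?mulr_gt0 // /x /exp_majorant.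
rewrite [leRHS](_ : _ = (`|r| * (`|q| * `|1 - q ^+ j.+1|)
   * `|1 + s * q ^+ j.+1|) / (j.+1%:R * (1 - `|q|) * delta)); last first.
  by rewrite !invfM; ring.
rewrite ler_pdivlMr ?mulr_gt0 //.
rewrite [leLHS](_ : _ = (`|r| * (j.+1%:R * `|q| ^+ j.+1 * (1 - `|q|))) * delta);
  last by ring.
by rewrite ler_pM ?mulr_ge0 ?exprn_ge0 ?ler_wpM2l // ltW.
Qed.

Lemma cvg_phi (R : realType) (r s q delta : R) :
    `|q| < 1 -> 0 < delta -> (forall i, delta <= `|1 + s * q ^+ i.+1|) ->
  series (phi_term r s q) @ \oo --> rphi r s q.
Proof.
move=> q1 delta0 sq; apply: normed_cvg.
apply: (series_le_cvg _ _ (fun j => phi_term_le r j q1 delta0 sq)) => //.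
  move=> j; apply: exp_coeff_ge0.
  by rewrite !mulr_ge0 ?invr_ge0 ?mulr_ge0 ?subr_ge0 // ltW.
exact: is_cvg_series_exp_coeff.
Qed.

(** This gives both a bound on phi and its convergence to 1 as [r] tends to 0,
    uniformly in [s] as long as [delta] is fixed. *)
Lemma rphi_sub1_le (R : realType) (r s q delta : R) :
    `|q| < 1 -> 0 < delta -> (forall i, delta <= `|1 + s * q ^+ i.+1|) ->
  `|rphi r s q - 1| <= expR (exp_majorant q delta r) - 1.
Proof.
move=> q1 delta0 sq; set x := exp_majorant q delta r.
have le n : `|series (phi_term r s q) n.+1 - 1| <= series (exp_coeff x) n.+1 - 1.
  elim: n => [|n IHn].
    rewrite !seriesSr /series /= !big_geq // !add0r phi_term0 subrr normr0.
    by rewrite /exp_coeff /= expr0 divr1 subrr.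
  rewrite ![series _ n.+2]seriesSr !(addrAC _ _ (-1)).
  by rewrite (le_trans (ler_normD _ _)) // lerD // phi_term_le.
have H : (fun n => `|series (phi_term r s q) n.+1 - 1|) @ \oo -->
    `|rphi r s q - 1|.
  apply: cvg_norm; apply: cvgB; last exact: cvg_cst.
  by rewrite (cvg_shiftS (series _)); apply: cvg_phi sq.
have E : (fun n => series (exp_coeff x) n.+1 - 1) @ \oo --> expR x - 1.
  apply: cvgB; last exact: cvg_cst.
  by rewrite (cvg_shiftS (series _)); exact: is_cvg_series_exp_coeff.
by apply: ler_cvg_to H E _; exact: nearW.
Qed.

Lemma qPoch_neq0 (K : fieldType) (x q : K) (j : nat) :
  (forall i, 1 - x * q ^+ i != 0) -> qPoch x q j != 0.
Proof. by move=> x0; apply/prodf_neq0 => i _. Qed.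

Lemma qPoch_neg_neq0 (K : fieldType) (s q : K) (j : nat) :
  (forall i, 1 + s * q ^+ i.+1 != 0) -> qPoch (- s * q) q j != 0.
Proof.
move=> s0; apply: qPoch_neq0 => i.
by rewrite !mulNr opprK -mulrA -exprS.
Qed.

(** Both sides have the common factor of [phi_term]; what is left is
    [(-s q; q)_j (1 + s q^(j+1)) = (1 + s q) (-s q^2; q)_j]. *)
Lemma phi_term_shift_s (K : fieldType) (r s q : K) (j : nat) :
    (forall i, 1 + s * q ^+ i.+1 != 0) ->
  (1 + s * q) * phi_term r s q j =
    phi_term r (s * q) q j + s * q * phi_term (r * q) (s * q) q j.
Proof.
move=> s0.
have sq0 i : 1 + s * q * q ^+ i.+1 != 0 by rewrite -mulrA -exprS.
have P0 := qPoch_neg_neq0 j s0; have P'0 := qPoch_neg_neq0 j sq0.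
have PP' : qPoch (- s * q) q j * (1 + s * q ^+ j.+1) =
    (1 + s * q) * qPoch (- (s * q) * q) q j.
  by have := qPochSl (- s * q) q j; rewrite qPochSr exprS mulrA !mulNr !opprK.
rewrite /phi_term exprMn !invfM.
move: P0 P'0 PP'; set P := qPoch (- s * q) q j.
set P' := qPoch (- (s * q) * q) q j => P0 P'0 PP'.
have PV : (1 + s * q) / P = (1 + s * q ^+ j.+1) / P'.
  by apply/eqP; rewrite eqr_div // -PP' mulrC.
rewrite exprS in PV.
transitivity (q ^+ ((j ^ 2 + j)./2) * r ^+ j / qPoch q q j * ((1 + s * q) / P)).
  by ring.
by rewrite PV; ring.
Qed.

(** In the difference of the two terms of index [j.+1] the factor [1 - q^(j+1)]
    cancels the last factor of [(q; q)_(j+1)], which leaves a term of index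
    [j]. *)
Lemma phi_term_shift_r (K : fieldType) (r s q : K) (j : nat) :
    (forall i, 1 - q ^+ i.+1 != 0) -> (forall i, 1 + s * q ^+ i.+1 != 0) ->
  phi_term r s q j.+1 = phi_term (r * q) s q j.+1 +
    r * q / (1 + s * q) * phi_term (r * q) (s * q) q j.
Proof.
move=> q1 s0.
have sq0 i : 1 + s * q * q ^+ i.+1 != 0 by rewrite -mulrA -exprS.
have P'0 := qPoch_neg_neq0 j sq0.
have Q0 : qPoch q q j != 0.
  by apply: qPoch_neq0 => i; rewrite -exprS.
have qj0 := q1 j.
have := s0 0%N; rewrite expr1 => s00.
rewrite /phi_term triangularS exprD qPochSr (qPochSl (- s * q)) -exprS.
rewrite !mulNr !opprK.
rewrite mulNr in P'0.
rewrite !exprMn !exprS; rewrite exprS in qj0; move: (q ^+ (_./2)) => a.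
by field; rewrite s00 P'0 Q0 qj0.
Qed.

Lemma rphi_shift_s (R : realType) (r s q delta : R) :
    `|q| < 1 -> 0 < delta -> (forall i, delta <= `|1 + s * q ^+ i.+1|) ->
  (1 + s * q) * rphi r s q = rphi r (s * q) q + s * q * rphi (r * q) (s * q) q.
Proof.
move=> q1 delta0 sq.
have s0 i : 1 + s * q ^+ i.+1 != 0.
  by rewrite -normr_gt0 (lt_le_trans delta0).
have sq' i : delta <= `|1 + s * q * q ^+ i.+1| by rewrite -mulrA -exprS.
have L : (fun n => (1 + s * q) * series (phi_term r s q) n) @ \oo -->
    (1 + s * q) * rphi r s q.
  by apply: cvgM; [exact: cvg_cst|apply: cvg_phi sq].
apply: (cvg_unique (@Rhausdorff R) L).
rewrite (_ : (fun n => _) = (fun n => series (phi_term r (s * q) q) n +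
    s * q * series (phi_term (r * q) (s * q) q) n)).
  apply: cvgD; first by apply: cvg_phi sq'.
  by apply: cvgM; [exact: cvg_cst|apply: cvg_phi sq'].
apply/funext => n; rewrite /series /= !big_distrr /= -big_split /=.
by apply: eq_bigr => j _; rewrite phi_term_shift_s.
Qed.

Lemma rphi_shift_r (R : realType) (r s q delta : R) :
    `|q| < 1 -> 0 < delta -> (forall i, delta <= `|1 + s * q ^+ i.+1|) ->
  rphi r s q = rphi (r * q) s q + r * q / (1 + s * q) * rphi (r * q) (s * q) q.
Proof.
move=> q1 delta0 sq.
have s0 i : 1 + s * q ^+ i.+1 != 0.
  by rewrite -normr_gt0 (lt_le_trans delta0).
have sq' i : delta <= `|1 + s * q * q ^+ i.+1| by rewrite -mulrA -exprS.
have L : (fun n => series (phi_term r s q) n.+1) @ \oo --> rphi r s q.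
  by rewrite (cvg_shiftS (series _)); apply: cvg_phi sq.
apply: (cvg_unique (@Rhausdorff R) L).
rewrite (_ : (fun n => _) = (fun n => series (phi_term (r * q) s q) n.+1 +
    r * q / (1 + s * q) * series (phi_term (r * q) (s * q) q) n)).
  apply: cvgD; first by rewrite (cvg_shiftS (series _)); apply: cvg_phi sq.
  by apply: cvgM; [exact: cvg_cst|apply: cvg_phi sq'].
apply/funext => n; rewrite /series /= !big_nat_recl // !phi_term0.
rewrite big_distrr -addrA -big_split /=.
congr (_ + _); apply: eq_bigr => j _.
by rewrite phi_term_shift_r // => i; exact: qpow_neq1.
Qed.

(** * The tails of the continued fraction of phi *)

(** The factor that clears the denominators [1 + s q^i] from the contiguous
    relations and normalises the numerators of the continued fraction to 1. *)
Definition phi_weight (K : fieldType) (c s q : K) (k : nat) : K :=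
  q ^+ ((k ^ 2 + k)./2)%N * c ^+ k / qPoch (- s * q) q k.

Definition upper_tail (R : realType) (r s q : R) (k : nat) : R :=
  phi_weight r s q k * rphi (r * q ^+ k) (s * q ^+ k) q.

Definition lower_tail (R : realType) (r s q : R) (k : nat) : R :=
  phi_weight s s q k * rphi (r * q ^+ k.+1) (s * q ^+ k) q.

Lemma phi_weightS (K : fieldType) (c s q : K) (k : nat) :
  phi_weight c s q k.+1 =
    phi_weight c s q k * (c * q ^+ k.+1 / (1 + s * q ^+ k.+1)).
Proof.
rewrite /phi_weight triangularS exprD [c ^+ _]exprSr qPochSr.
rewrite !mulNr opprK -[s * q * _]mulrA -!exprS !invfM; ring.
Qed.

Lemma upper_tailE (R : realType) (r s q delta : R) (k : nat) :
    s != 0 -> `|q| < 1 -> 0 < delta ->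
    (forall i, delta <= `|1 + s * q ^+ i.+1|) ->
  upper_tail r s q k = (r / s) ^+ k * lower_tail r s q k + upper_tail r s q k.+1.
Proof.
move=> s0 q1 delta0 sq; rewrite /upper_tail /lower_tail phi_weightS.
have sqk i : delta <= `|1 + s * q ^+ k * q ^+ i.+1|.
  by rewrite -mulrA -exprD addnS.
have := rphi_shift_r (r * q ^+ k) q1 delta0 sqk.
rewrite -!(mulrA r (q ^+ k)) -!(mulrA s (q ^+ k)) -!exprSr => ->.
have -> : phi_weight r s q k = (r / s) ^+ k * phi_weight s s q k.
  rewrite /phi_weight expr_div_n; move: (qPoch _ _ _)^-1 => P.
  by field; rewrite expf_neq0.
by ring.
Qed.

Lemma lower_tailE (R : realType) (r s q delta : R) (k : nat) :
    r != 0 -> q != 0 -> `|q| < 1 -> 0 < delta ->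
    (forall i, delta <= `|1 + s * q ^+ i.+1|) ->
  lower_tail r s q k = s ^+ k * (r * q) ^- k.+1 * upper_tail r s q k.+1
    + lower_tail r s q k.+1.
Proof.
move=> r0 q0 q1 delta0 sq; rewrite /upper_tail /lower_tail !phi_weightS.
have sk0 : 1 + s * q ^+ k.+1 != 0 by rewrite -normr_gt0 (lt_le_trans delta0).
have sqk i : delta <= `|1 + s * q ^+ k * q ^+ i.+1|.
  by rewrite -mulrA -exprD addnS.
have := rphi_shift_s (r * q ^+ k.+1) q1 delta0 sqk.
rewrite -!(mulrA r (q ^+ _)) -!(mulrA s (q ^+ _)) -!exprSr.
move=> /(canRL (mulKf sk0)) ->.
rewrite /phi_weight; set P := (qPoch _ _ _)^-1.
rewrite mulrDr mulrDr; congr (_ + _); last by ring.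
rewrite exprMn [r ^+ _]exprSr [in RHS]exprSr.
move: (q ^+ (_./2)) => a; rewrite exprSr in sk0 *.
have rk : r ^+ k != 0 by rewrite expf_neq0.
have qk : q ^+ k != 0 by rewrite expf_neq0.
move: (rphi _ _ _) => h; field.
by rewrite sk0 rk qk q0 r0.
Qed.

Lemma exp_coeff_le_expR (R : realType) (x : R) (k : nat) :
  0 <= x -> exp_coeff x k <= expR x.
Proof.
move=> x0; have e0 i := exp_coeff_ge0 i x0.
apply: (@le_trans _ _ (series (exp_coeff x) k.+1)).
  by rewrite seriesSr lerDr sumr_ge0.
apply: nondecreasing_cvgn_le; last exact: is_cvg_series_exp_coeff.
by apply/nondecreasing_seqP => i; rewrite seriesSr lerDl.
Qed.

Lemma exp_majorant_ge0 (R : realType) (q delta r : R) :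
  `|q| < 1 -> 0 < delta -> 0 <= exp_majorant q delta r.
Proof.
by move=> q1 delta0; rewrite !mulr_ge0 ?invr_ge0 ?mulr_ge0 ?subr_ge0 // ltW.
Qed.

(** The weight is a term of phi without the factor [1 / (q; q)_k], and
    [|(q; q)_k| <= 2^k] only doubles the argument of the majorant. *)
Lemma phi_weight_le (R : realType) (c s q delta : R) (k : nat) :
    `|q| < 1 -> 0 < delta -> (forall i, delta <= `|1 + s * q ^+ i.+1|) ->
  `|phi_weight c s q k| <= expR (exp_majorant q delta c * 2).
Proof.
move=> q1 delta0 sq; have x0 := exp_majorant_ge0 c q1 delta0.
have -> : phi_weight c s q k = phi_term c s q k * qPoch q q k.
  rewrite /phi_term invfM mulrA mulrAC divfK //.
  by apply: qPoch_neq0 => i; rewrite -exprS qpow_neq1.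
apply: le_trans (exp_coeff_le_expR k (mulr_ge0 x0 (ler0n _ 2))).
rewrite /exp_coeff /= exprMn [leRHS]mulrAC normrM ler_pM //.
  exact: (phi_term_le c k q1 delta0 sq).
rewrite /qPoch normr_prod -[X in _ ^+ X]card_ord -prodr_const.
apply: ler_prod => i _; rewrite normr_ge0 (le_trans (ler_normB _ _)) //.
by rewrite normr1 -[2]/(1 + 1) lerD2l -exprS normrX exprn_ile1 // ltW.
Qed.

Lemma exp_majorant_shift (R : realType) (q delta r : R) (k : nat) :
  exp_majorant q delta (r * q ^+ k) = exp_majorant q delta r * `|q| ^+ k.
Proof. by rewrite /exp_majorant normrM normrX; ring. Qed.

Lemma rphi_shift_le (R : realType) (r s q delta : R) (k : nat) :
    `|q| < 1 -> 0 < delta -> (forall i, delta <= `|1 + s * q ^+ i.+1|) ->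
  `|rphi r (s * q ^+ k) q| <= expR (exp_majorant q delta r).
Proof.
move=> q1 delta0 sq.
have := @rphi_sub1_le _ r (s * q ^+ k) q delta q1 delta0.
rewrite -[X in _ -> _ <= X](subrK 1) => /(_ _) le1.
rewrite -[X in `|X|](subrK 1) (le_trans (ler_normD _ _)) // normr1 lerD2r le1 //.
by move=> i; rewrite -mulrA -exprD addnS.
Qed.

Lemma tails_bounded (R : realType) (r s q delta : R) :
    `|q| < 1 -> 0 < delta -> (forall i, delta <= `|1 + s * q ^+ i.+1|) ->
  exists B, forall k, `|upper_tail r s q k| <= B /\ `|lower_tail r s q k| <= B.
Proof.
move=> q1 delta0 sq; set x := exp_majorant q delta.
have xr k : expR (x (r * q ^+ k)) <= expR (x r).
  rewrite ler_expR /x exp_majorant_shift ler_piMr ?exp_majorant_ge0 //.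
  by rewrite exprn_ile1 // ltW.
have le c k k' : `|phi_weight c s q k * rphi (r * q ^+ k') (s * q ^+ k) q| <=
    expR (x c * 2) * expR (x r).
  rewrite normrM ler_pM //; first exact: phi_weight_le.
  by apply: le_trans (xr k'); apply: rphi_shift_le.
exists (expR (x r * 2) * expR (x r) + expR (x s * 2) * expR (x r)) => k.
split; apply: le_trans (le _ _ _) _.
  by rewrite lerDl mulr_ge0 // expR_ge0.
by rewrite lerDr mulr_ge0 // expR_ge0.
Qed.

(** The factor [rphi (r q^k) (s q^k) q] tends to 1. *)
Lemma upper_tail_neq0 (R : realType) (r s q delta : R) :
    r != 0 -> q != 0 -> `|q| < 1 -> 0 < delta ->
    (forall i, delta <= `|1 + s * q ^+ i.+1|) ->
  \forall k \near \oo, upper_tail r s q k != 0.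
Proof.
move=> r0 q0 q1 delta0 sq; set x := exp_majorant q delta.
have lim0 : (fun k => x r * `|q| ^+ k) @ \oo --> (0 : R).
  by apply: cvg_geometric; rewrite normr_id.
have lim1 : (fun k => expR (x r * `|q| ^+ k)) @ \oo --> (1 : R).
  by rewrite -expR0; apply: continuous_cvg lim0; exact: continuous_expR.
near=> k; rewrite mulf_neq0 //.
  rewrite mulf_neq0 ?mulf_neq0 ?expf_neq0 // invr_neq0 //.
  by apply: qPoch_neg_neq0 => i; rewrite -normr_gt0 (lt_le_trans delta0).
have sqk i : delta <= `|1 + s * q ^+ k * q ^+ i.+1|.
  by rewrite -mulrA -exprD addnS.
apply: contraTneq (rphi_sub1_le (r * q ^+ k) q1 delta0 sqk) => ->.
rewrite sub0r normrN normr1 -ltNge ltrBlDr exp_majorant_shift.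
near: k; apply: (cvgr_lt _ lim1); lra.
Unshelve. all: by end_near.
Qed.

(** * From tails to values over the complex numbers *)

(** [U] and [V] are the even and odd tails of the formal continued fraction
    [1; nu, mu, d nu^2, mu^2, d^2 nu^3, ...], whose quotients may be negative. *)
Definition signed_tails (R : realType) (mu d nu : rat) (U V : nat -> R) :=
  [/\ forall k, U k = ratr (mu ^+ k) * V k + U k.+1,
      forall k, V k = ratr (d ^+ k * nu ^+ k.+1) * U k.+1 + V k.+1,
      exists B, forall k, `|U k| <= B /\ `|V k| <= B
    & \forall k \near \oo, U k != 0].

Lemma phi_tails (R : realType) (mu d nu : rat) (delta : R)
    (r := ratr (d * mu) : R) (s := ratr d : R) (q := ratr (d * mu * nu)^-1 : R) :
    1 < `|d * mu * nu| -> 0 < delta ->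
    (forall i, delta <= `|1 + s * q ^+ i.+1|) ->
  signed_tails mu d nu (upper_tail r s q) (lower_tail r s q).
Proof.
move=> p1 delta0 sq.
have : d * mu * nu != 0 by rewrite -normr_gt0 (lt_trans ltr01).
rewrite !mulf_eq0 !negb_or => /andP[/andP[d0 mu0] nu0].
have q1 : `|q| < 1.
  have p0 : 0 < `|ratr (d * mu * nu) : R|.
    by rewrite normr_gt0 fmorph_eq0 !mulf_neq0.
  rewrite /q fmorphV normfV invf_lt1 //.
  by rewrite -ratr_norm -(rmorph1 ratr) ltr_rat.
have s0 : s != 0 by rewrite fmorph_eq0.
have r0 : r != 0 by rewrite fmorph_eq0 mulf_neq0.
have q0 : q != 0 by rewrite fmorph_eq0 invr_neq0 ?mulf_neq0.
split=> [k|k||]; first last.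
- exact: upper_tail_neq0 r0 q0 q1 delta0 sq.
- exact: tails_bounded sq.
- rewrite {1}(lower_tailE k r0 q0 q1 delta0 sq) rmorphM !rmorphXn /=.
  congr (ratr d ^+ k * _ * _ + _).
  rewrite -exprVn; congr (_ ^+ _).
  by rewrite -rmorphM -fmorphV /=; congr ratr; field; rewrite d0 mu0 nu0.
- rewrite {1}(upper_tailE r k s0 q1 delta0 sq) rmorphXn /=.
  congr (_ ^+ _ * _ + _).
  by rewrite -fmorphV -rmorphM /=; congr ratr; field.
Qed.

Lemma tails0 (R : realType) (r s q : R) :
  upper_tail r s q 0 / lower_tail r s q 0 = rphi r s q / rphi (r * q) s q.
Proof.
have w1 c : phi_weight c s q 0 = 1.
  rewrite /phi_weight (_ : (0 ^ 2 + 0)./2 = 0)%N // /qPoch big_ord0.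
  by rewrite !expr0 !mulr1 divr1.
by rewrite /upper_tail /lower_tail !w1 !mul1r expr0 expr1 !mulr1.
Qed.

Lemma cvg_real_complex (R : realType) (u : nat -> R) (l : R) :
  u @ \oo --> l ->
  (fun n => (real_complex R (u n) : R[i]^o)) @ \oo -->
    (real_complex R l : R[i]^o).
Proof.
move=> /cvgrPdist_lt ul; apply/cvgrPdist_lt => e.
rewrite ltcE /= => /andP[/eqP e0 eR].
have := ul _ eR; apply: filterS => n un.
by rewrite -rmorphB normc_def ltcE /= expr0n addr0 sqrtr_sqr e0 eqxx.
Qed.

Lemma phi_ratr (R : realType) (r s q : rat) (delta : R) :
    `|q| < 1 -> 0 < delta ->
    (forall i, delta <= `|1 + ratr s * ratr q ^+ i.+1|) ->
  phi (ratr r : R[i]) (ratr s) (ratr q) =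
    real_complex R (rphi (ratr r) (ratr s) (ratr q)).
Proof.
move=> q1 delta0 sq.
have q1' : `|ratr q : R| < 1 by rewrite -ratr_norm -(rmorph1 ratr) ltr_rat.
have := cvg_real_complex (cvg_phi (r := ratr r) q1' delta0 sq).
rewrite /phi; set u := (X in X @ \oo --> _).
have -> : u = (series (phi_term (ratr r) (ratr s) (ratr q)) : nat -> R[i]^o).
  apply/funext => n; rewrite /u /series /= rmorph_sum /=; apply: eq_bigr => j _.
  rewrite /phi_term /qPoch fmorph_div !rmorphM !rmorphXn /= !rmorph_prod.
  rewrite !fmorph_rat; congr (_ / (_ * _)); apply: eq_bigr => i _.
    by rewrite rmorphB rmorph1 rmorphM rmorphXn /= fmorph_rat.
  by rewrite rmorphB rmorph1 rmorphM rmorphXn /= rmorphM rmorphN /= !fmorph_rat.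
by apply: cvg_lim; exact: norm_hausdorff.
Qed.

(** The reduction of the analytic statement to an algebraic one about tails;
    1/2 is a lower bound for the denominators that suits all four sign
    patterns. *)
Lemma phi_cf_value (R : realType) (mu d nu : rat) (a : nat -> rat) :
    1 < `|d * mu * nu| ->
    (forall i, 2^-1 <= `|1 + d * (d * mu * nu)^-1 ^+ i.+1|) ->
    (forall U V : nat -> R, signed_tails mu d nu U V ->
       regular_cf a /\
       (fun N => ratr (convergent a N) : R) @ \oo --> U 0%N / V 0%N) ->
  regular_cf_value a
    (phi (ratr (d * mu) : R[i]) (ratr d) (ratr (d * mu * nu)^-1) /
     phi (ratr nu^-1) (ratr d) (ratr (d * mu * nu)^-1)).
Proof.
move=> p1 dq aUV.
have half0 : 0 < (2^-1 : R) by rewrite invr_gt0.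
have dqR i : (2^-1 : R) <= `|1 + ratr d * ratr (d * mu * nu)^-1 ^+ i.+1|.
  have := dq i; rewrite -(ler_rat R) fmorphV rmorph_nat ratr_norm.
  by rewrite rmorphD rmorph1 rmorphM rmorphXn.
have q1 : `|(d * mu * nu)^-1| < 1.
  by rewrite normfV invf_lt1 // (lt_trans ltr01).
have [areg acvg] := aUV _ _ (phi_tails p1 half0 dqR); split=> //.
rewrite !(phi_ratr _ q1 half0 dqR) -fmorph_div /=.
have : d * mu * nu != 0 by rewrite -normr_gt0 (lt_trans ltr01).
rewrite !mulf_eq0 !negb_or => /andP[/andP[d0 mu0] nu0].
rewrite tails0 -rmorphM /= in acvg.
rewrite (_ : d * mu * (d * mu * nu)^-1 = nu^-1) in acvg; last first.
  by field; rewrite d0 mu0 nu0.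
have := cvg_real_complex acvg.
by under eq_fun do rewrite fmorph_rat.
Qed.

(** * The regular expansions for the four sign patterns *)

Lemma natpow_int (m k : nat) : (0 < m)%N ->
  (m%:R ^+ k.+1 : rat) \is a Num.int /\ m%:R <= m%:R ^+ k.+1 :> rat.
Proof.
move=> m0; split; first by rewrite rpredX // natr_int.
by rewrite exprS ler_peMr ?ler0n // exprn_ege1 // ler1n.
Qed.

Lemma dnpow_int (d : rat) (n k : nat) :
    d * n%:R \is a Num.int -> 0 < d * n%:R ->
  d ^+ k * n%:R ^+ k.+1 \is a Num.int /\ n%:R <= d ^+ k * n%:R ^+ k.+1.
Proof.
move=> dnZ dn0; rewrite exprSr mulrA -exprMn.
split; first by rewrite rpredM ?rpredX // natr_int.
by rewrite ler_peMl ?ler0n // exprn_ege1 // int_gt0_ge1.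
Qed.

Lemma exprN_even (K : pzRingType) (x : K) (k : nat) :
  (- x) ^+ (2 * k)%N = x ^+ (2 * k)%N.
Proof. by rewrite !exprM sqrrN. Qed.

Lemma exprN_odd (K : pzRingType) (x : K) (k : nat) :
  (- x) ^+ (2 * k)%N.+1 = - x ^+ (2 * k)%N.+1.
Proof. by rewrite !exprS exprN_even mulNr. Qed.

Lemma exprN_evenS (K : pzRingType) (x : K) (k : nat) :
  (- x) ^+ (2 * k)%N.+2 = x ^+ (2 * k)%N.+2.
Proof. by rewrite exprS exprN_odd mulrNN -exprS. Qed.

Lemma posint_entry (z b c : rat) :
    z \is a Num.int -> c <= z -> b \is a Num.int -> b < c ->
  (z - b \is a Num.int) && (0 < z - b).
Proof. by move=> zZ cz bZ bc; rewrite rpredB //= subr_gt0 (lt_le_trans bc). Qed.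

(** Rewriting [a - 1/(x - 1/Y)] with positive quotients changes the sign of all
    later tails.  When this happens once per block, the tails [w k] of block [k]
    may be written without the accumulated sign [(-1)^k]. *)
Lemma cf_alternating_blocks (R : realType) (a0 : rat) (r : nat)
    (f : nat -> r.-tuple rat) (X0 : R) (w : nat -> seq R) (B : R) :
    (1 < r)%N ->
    a0 \is a Num.int ->
    (forall k, all (fun z => (z \is a Num.int) && (0 < z)) (f k.+1)) ->
    X0 = ratr a0 * (w 0%N)`_0 + (w 0%N)`_1 ->
    (forall k c, (c < r)%N ->
       (w k)`_c = ratr (f k.+1)`_c * (w k)`_c.+1 + (w k)`_c.+2) ->
    (forall k, (w k)`_r = - (w k.+1)`_0) ->
    (forall k, (w k)`_r.+1 = - (w k.+1)`_1) ->
    `|X0| <= B -> (forall k c, (c < r)%N -> `|(w k)`_c| <= B) ->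
    (exists k c, (c < r)%N /\ (w k)`_c != 0) ->
  regular_cf (cf_blocks a0 f) /\
  (fun N => ratr (convergent (cf_blocks a0 f) N) : R) @ \oo -->
    X0 / (w 0%N)`_0.
Proof.
move=> r1 a0Z fpos X0E wE wr wrS X0B wB [k [c [cr wkc]]].
have y0 c' : (-1) ^+ 0 * (w 0%N)`_c' = (w 0%N)`_c' by rewrite mul1r.
rewrite -(y0 0%N).
apply: (cf_blocks_tails (y := fun k c => (-1) ^+ k * (w k)`_c) (B := B)) => //.
- by rewrite !y0.
- by move=> k' c' c'r; rewrite wE //; ring.
- by move=> k'; rewrite wr exprS; ring.
- by move=> k'; rewrite wrS exprS; ring.
- by move=> k' c' c'r; rewrite normrM normrX normrN1 expr1n mul1r wB.
- by exists k, c; rewrite mulf_neq0 ?signr_eq0.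
Qed.

Lemma double_index (k : nat) :
  ((2 * k.+1 - 2 = 2 * k)%N * (2 * k.+1 - 1 = (2 * k).+1)%N *
   (2 * k.+1 = (2 * k).+2)%N)%type.
Proof. by split; [split|]; lia. Qed.

Lemma cf_positive (R : realType) (m n : nat) (d : rat) (U V : nat -> R)
    (m_gt0 : (0 < m)%N) (n_gt0 : (0 < n)%N)
    (dn_int : d * n%:R \is a Num.int) (dn_gt0 : 0 < d * n%:R)
    (a := cf_blocks 1 (fun k =>
       [tuple d ^+ (k - 1) * n%:R ^+ k; m%:R ^+ k])) :
    signed_tails m%:R d n%:R U V ->
  regular_cf a /\
  (fun N => ratr (convergent a N) : R) @ \oo --> U 0%N / V 0%N.
Proof.
move=> [UE VE [B UVB] [K _ UN0]].
pose y k c := nth 0 [:: V k; U k.+1; V k.+1; U k.+2] c.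
apply: (cf_blocks_tails (y := y) (B := B)) => //.
- move=> k /=; rewrite subn1 /= andbT.
  have [dnZ dnn] := dnpow_int k dn_int dn_gt0.
  have [mZ mm] := natpow_int k m_gt0.
  by rewrite dnZ mZ !(lt_le_trans _ dnn, lt_le_trans _ mm) ?ltr0n.
- by move=> k [|[|c]] //= _; rewrite ?subn1 /= -?VE -?UE.
- by have [] := UVB 0%N.
- by move=> k [|[|c]] //= _; [have [] := UVB k|have [] := UVB k.+1].
- by exists K, 1%N; split=> //; apply: UN0 => /=.
Qed.

(** Let three consecutive relations be [E0 = a E1 + E2], [E1 = - x E2 + E3],
    [E2 = y E3 + E4].  Then [E0, E1, E1 + E2, - E2, E3 - E2, - E3, - E4] are
    tails for the quotients [a - 1, 1, x - 2, 1, y - 1].  Here the negative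
    quotients are the [V]-quotients of even index, so that [E0] is a [U] of even
    index. *)
Lemma cf_negative_nu (R : realType) (m n : nat) (d : rat) (U V : nat -> R)
    (m_gt1 : (1 < m)%N) (n_gt2 : (2 < n)%N)
    (dn_int : d * n%:R \is a Num.int) (dn_gt0 : 0 < d * n%:R)
    (a := cf_blocks 0 (fun k =>
           [tuple 1; d ^+ (2 * k - 2) * n%:R ^+ (2 * k - 1) - 2; 1;
                  m%:R ^+ (2 * k - 1) - 1;
                  d ^+ (2 * k - 1) * n%:R ^+ (2 * k); m%:R ^+ (2 * k) - 1])) :
    signed_tails m%:R d (- n%:R) U V ->
  regular_cf a /\
  (fun N => ratr (convergent a N) : R) @ \oo --> U 0%N / V 0%N.
Proof.
move=> [UE VE [B UVB] [K _ UN0]].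
pose w k := let i := (2 * k)%N in
  [:: V i; V i + U i.+1; - U i.+1; V i.+1 - U i.+1; - V i.+1; - U i.+2;
      - V i.+2; - (V i.+2 + U i.+3)].
apply: (cf_alternating_blocks (w := w) (B := B + B)) => //.
- move=> k /=; rewrite !double_index.
  have [dZ dn] := dnpow_int (2 * k) dn_int dn_gt0.
  have [dZ' dn'] := dnpow_int (2 * k).+1 dn_int dn_gt0.
  have [mZ mm] := natpow_int (2 * k) (ltnW m_gt1).
  have [mZ' mm'] := natpow_int (2 * k).+1 (ltnW m_gt1).
  rewrite (posint_entry dZ dn) ?ltr_nat // (posint_entry mZ mm) ?ltr1n //.
  rewrite (posint_entry mZ' mm') ?ltr1n ?ltr_nat // dZ' (lt_le_trans _ dn') //.
  by rewrite ltr0n; lia.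
- by rewrite (UE 0%N) expr0 rmorph0 rmorph1 /=; ring.
- move=> k c c6.
  have := VE (2 * k)%N; have := UE (2 * k).+1; have := VE (2 * k).+1.
  have := UE (2 * k).+2.
  rewrite exprN_odd exprN_evenS mulrN rmorphN /= => U2 V1 U1 V0.
  case: c c6 => [|[|[|[|[|[|c]]]]]] //= _; rewrite ?double_index /=;
    rewrite ?rmorphB ?rmorph1 ?rmorph_nat /= ?V0 ?U1 ?V1 ?U2; ring.
- by move=> k; rewrite /w !double_index /=.
- by move=> k; rewrite /w !double_index /=.
- have [UB _] := UVB 0%N.
  by rewrite (le_trans UB) // lerDl (le_trans _ UB).
- move=> k c; have [[_ V0] [U1 V1] [U2 V2]] :=
    And3 (UVB (2 * k)%N) (UVB (2 * k).+1) (UVB (2 * k).+2).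
  move: V0 U1 V1 U2 V2; rewrite !ler_norml.
  case: c => [|[|[|[|[|[|c]]]]]] //=; lra.
- exists K, 2%N; split=> //=; rewrite oppr_eq0.
  by apply: UN0; rewrite /=; lia.
Qed.

(** The same transformation, where the negative quotients are the
    [U]-quotients of odd index and [E0] is a [V] of even index. *)
Lemma cf_negative_mu (R : realType) (m n : nat) (d : rat) (U V : nat -> R)
    (m_gt2 : (2 < m)%N) (n_gt1 : (1 < n)%N)
    (dn_int : d * n%:R \is a Num.int) (dn_gt0 : 0 < d * n%:R)
    (a := cf_blocks 1 (fun k =>
           [tuple d ^+ (2 * k - 2) * n%:R ^+ (2 * k - 1) - 1; 1;
                  m%:R ^+ (2 * k - 1) - 2; 1;
                  d ^+ (2 * k - 1) * n%:R ^+ (2 * k) - 1; m%:R ^+ (2 * k)])) :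
    signed_tails (- m%:R) d n%:R U V ->
  regular_cf a /\
  (fun N => ratr (convergent a N) : R) @ \oo --> U 0%N / V 0%N.
Proof.
move=> [UE VE [B UVB] [K _ UN0]].
pose w k := let i := (2 * k)%N in
  [:: V i; U i.+1; U i.+1 + V i.+1; - V i.+1; U i.+2 - V i.+1; - U i.+2;
      - V i.+2; - U i.+3].
apply: (cf_alternating_blocks (w := w) (B := B + B)) => //.
- move=> k /=; rewrite !double_index.
  have [dZ dn] := dnpow_int (2 * k) dn_int dn_gt0.
  have [dZ' dn'] := dnpow_int (2 * k).+1 dn_int dn_gt0.
  have m_gt0 : (0 < m)%N by lia.
  have [mZ mm] := natpow_int (2 * k) m_gt0.
  have [mZ' mm'] := natpow_int (2 * k).+1 m_gt0.
  rewrite (posint_entry dZ dn) ?ltr1n // (posint_entry mZ mm) ?ltr_nat //.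
  by rewrite (posint_entry dZ' dn') ?ltr1n // mZ' (lt_le_trans _ mm') ?ltr0n.
- move=> k c c6.
  have := VE (2 * k)%N; have := UE (2 * k).+1; have := VE (2 * k).+1.
  have := UE (2 * k).+2.
  rewrite exprN_odd exprN_evenS rmorphN /= => U2 V1 U1 V0.
  case: c c6 => [|[|[|[|[|[|c]]]]]] //= _; rewrite ?double_index /=;
    rewrite ?rmorphB ?rmorph1 ?rmorph_nat /= ?V0 ?U1 ?V1 ?U2; ring.
- by move=> k; rewrite /w !double_index /=.
- by move=> k; rewrite /w !double_index /=.
- have [UB _] := UVB 0%N.
  by rewrite (le_trans UB) // lerDl (le_trans _ UB).
- move=> k c; have [[_ V0] [U1 V1] [U2 V2]] :=
    And3 (UVB (2 * k)%N) (UVB (2 * k).+1) (UVB (2 * k).+2).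
  move: V0 U1 V1 U2 V2; rewrite !ler_norml.
  case: c => [|[|[|[|[|[|c]]]]]] //=; lra.
- by exists K, 1%N; split=> //=; apply: UN0; rewrite /=; lia.
Qed.

(** The same transformation, where the negative quotients are the
    [V]-quotients of odd index and [E0] is a [U] of odd index. *)
Lemma cf_negative_d (R : realType) (m n : nat) (d : rat) (U V : nat -> R)
    (m_gt1 : (1 < m)%N) (n_gt2 : (2 < n)%N)
    (dn_int : d * n%:R \is a Num.int) (dn_gt0 : 0 < d * n%:R)
    (a := cf_blocks 1 (fun k =>
           [tuple d ^+ (2 * k - 2) * n%:R ^+ (2 * k - 1);
                  m%:R ^+ (2 * k - 1) - 1; 1;
                  d ^+ (2 * k - 1) * n%:R ^+ (2 * k) - 2; 1;
                  m%:R ^+ (2 * k) - 1])) :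
    signed_tails m%:R (- d) n%:R U V ->
  regular_cf a /\
  (fun N => ratr (convergent a N) : R) @ \oo --> U 0%N / V 0%N.
Proof.
move=> [UE VE [B UVB] [K _ UN0]].
pose w k := let i := (2 * k)%N in
  [:: V i; U i.+1; V i.+1; V i.+1 + U i.+2; - U i.+2; V i.+2 - U i.+2;
      - V i.+2; - U i.+3].
apply: (cf_alternating_blocks (w := w) (B := B + B)) => //.
- move=> k /=; rewrite !double_index.
  have [dZ dn] := dnpow_int (2 * k) dn_int dn_gt0.
  have [dZ' dn'] := dnpow_int (2 * k).+1 dn_int dn_gt0.
  have [mZ mm] := natpow_int (2 * k) (ltnW m_gt1).
  have [mZ' mm'] := natpow_int (2 * k).+1 (ltnW m_gt1).
  rewrite (posint_entry mZ mm) ?ltr1n // (posint_entry mZ' mm') ?ltr1n //.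
  rewrite (posint_entry dZ' dn') ?ltr_nat // dZ (lt_le_trans _ dn) //.
  by rewrite ltr0n; lia.
- move=> k c c6.
  have := VE (2 * k)%N; have := UE (2 * k).+1; have := VE (2 * k).+1.
  have := UE (2 * k).+2.
  rewrite exprN_odd exprN_even mulNr rmorphN /= => U2 V1 U1 V0.
  case: c c6 => [|[|[|[|[|[|c]]]]]] //= _; rewrite ?double_index /=;
    rewrite ?rmorphB ?rmorph1 ?rmorph_nat /= ?V0 ?U1 ?V1 ?U2; ring.
- by move=> k; rewrite /w !double_index /=.
- by move=> k; rewrite /w !double_index /=.
- have [UB _] := UVB 0%N.
  by rewrite (le_trans UB) // lerDl (le_trans _ UB).
- move=> k c; have [[_ V0] [U1 V1] [U2 V2]] :=
    And3 (UVB (2 * k)%N) (UVB (2 * k).+1) (UVB (2 * k).+2).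
  move: V0 U1 V1 U2 V2; rewrite !ler_norml.
  case: c => [|[|[|[|[|[|c]]]]]] //=; lra.
- by exists K, 1%N; split=> //=; apply: UN0; rewrite /=; lia.
Qed.

(** Because [d q^(i+1) = q^i / (mu nu)] has modulus at most 1/2. *)
Lemma denominator_ge_half (mu d nu : rat) (i : nat) :
    1 < `|d * mu * nu| -> 2 <= `|mu * nu| ->
  2^-1 <= `|1 + d * (d * mu * nu)^-1 ^+ i.+1|.
Proof.
move=> p1 mn2; have p0 : d * mu * nu != 0.
  by rewrite -normr_gt0 (lt_trans ltr01).
have := p0; rewrite !mulf_eq0 !negb_or => /andP[/andP[d0 mu0] nu0].
have -> : d * (d * mu * nu)^-1 ^+ i.+1 = (mu * nu)^-1 * (d * mu * nu)^-1 ^+ i.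
  by rewrite exprS; move: (_ ^+ i) => z; field; rewrite d0 mu0 nu0.
set z := _ * _ ^+ i.
have z2 : `|z| <= 2^-1.
  rewrite /z normrM normfV normrX normfV -[leRHS]mulr1 ler_pM ?invr_ge0 //.
  - by rewrite lef_pV2 // posrE (lt_le_trans _ mn2).
  - by rewrite exprn_ile1 ?invr_ge0 // invf_le1 ?ltW // (lt_trans ltr01).
have := lerB_normD 1 z; rewrite normr1; lra.
Qed.

(** * The four identities *)

Theorem theorem8 (R : realType) (m n : nat) (d : rat)
  (m_gt0 : (0 < m)%N) (n_gt0 : (0 < n)%N)
  (dn_int : d * n%:R \is a Num.int) (dn_gt0 : 0 < d * n%:R)
  (dmn_gt1 : 1 < d * m%:R * n%:R) :
  let M : R[i] := m%:R in
  let N : R[i] := n%:R in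
  let D : R[i] := ratr d in
  [/\ regular_cf_value
        (cf_blocks 1 (fun k => [tuple d ^+ (k - 1) * n%:R ^+ k; m%:R ^+ k]))
        (phi (D * M) D (1 / (D * M * N)) / phi (1 / N) D (1 / (D * M * N))),
      (2 < n)%N -> (1 < m)%N ->
      regular_cf_value
        (cf_blocks 0 (fun k =>
           [tuple 1; d ^+ (2 * k - 2) * n%:R ^+ (2 * k - 1) - 2; 1;
                  m%:R ^+ (2 * k - 1) - 1;
                  d ^+ (2 * k - 1) * n%:R ^+ (2 * k); m%:R ^+ (2 * k) - 1]))
        (phi (D * M) D (- 1 / (D * M * N)) /
         phi (- 1 / N) D (- 1 / (D * M * N))),
      (2 < m)%N -> (1 < n)%N ->
      regular_cf_value
        (cf_blocks 1 (fun k =>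
           [tuple d ^+ (2 * k - 2) * n%:R ^+ (2 * k - 1) - 1; 1;
                  m%:R ^+ (2 * k - 1) - 2; 1;
                  d ^+ (2 * k - 1) * n%:R ^+ (2 * k) - 1; m%:R ^+ (2 * k)]))
        (phi (- D * M) D (- 1 / (D * M * N)) /
         phi (1 / N) D (- 1 / (D * M * N)))
    & (2 < n)%N -> (1 < m)%N ->
      regular_cf_value
        (cf_blocks 1 (fun k =>
           [tuple d ^+ (2 * k - 2) * n%:R ^+ (2 * k - 1);
                  m%:R ^+ (2 * k - 1) - 1; 1;
                  d ^+ (2 * k - 1) * n%:R ^+ (2 * k) - 2; 1;
                  m%:R ^+ (2 * k) - 1]))
        (phi (- D * M) (- D) (- 1 / (D * M * N)) /
         phi (1 / N) (- D) (- 1 / (D * M * N)))].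
Proof.
move=> M N D.
have m0 : 0 < m%:R :> rat by rewrite ltr0n.
have n0 : 0 < n%:R :> rat by rewrite ltr0n.
have d0 : 0 < d by rewrite -(pmulr_lgt0 _ n0).
have mnd_gt1 : 1 < `|d * m%:R * n%:R| by rewrite gtr0_norm // !mulr_gt0.
have mn2 : (2 < n)%N && (1 < m)%N || (2 < m)%N && (1 < n)%N ->
    2 <= `|m%:R * n%:R : rat|.
  by move=> mn; rewrite -natrM normr_nat ler_nat; nia.
have DE : D = ratr d by []. have ME : M = ratr m%:R by rewrite ratr_nat.
have NE : N = ratr n%:R by rewrite ratr_nat.
rewrite !mulNr !div1r.
split.
- have := @phi_cf_value R m%:R d n%:R _ mnd_gt1 _ (fun U V =>
     cf_positive m_gt0 n_gt0 dn_int dn_gt0).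
  rewrite !fmorphV !rmorphM /= -DE -ME -NE; apply => i.
  have : 0 <= d * (d * m%:R * n%:R)^-1 ^+ i.+1.
    by rewrite mulr_ge0 ?exprn_ge0 ?invr_ge0 ?mulr_ge0 // ltW.
  by move=> z0; rewrite ger0_norm ?addr_ge0 //; lra.
- move=> n2 m1; have := @phi_cf_value R m%:R d (- n%:R) _ _ _ (fun U V =>
     cf_negative_nu m1 n2 dn_int dn_gt0).
  rewrite mulrN !invrN !rmorphN !fmorphV !rmorphM /= -DE -ME -NE.
  apply; first by rewrite normrN.
  move=> i; rewrite -invrN -mulrN; apply: denominator_ge_half;
    rewrite mulrN normrN //.
  by rewrite mn2 // n2 m1.
- move=> m2 n1; have := @phi_cf_value R (- m%:R) d n%:R _ _ _ (fun U V =>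
     cf_negative_mu m2 n1 dn_int dn_gt0).
  rewrite mulrN mulNr !invrN !rmorphN !fmorphV !rmorphM /= -DE -ME -NE.
  apply; first by rewrite normrN.
  move=> i; rewrite -invrN -mulNr -mulrN; apply: denominator_ge_half;
    rewrite ?mulrN mulNr normrN //.
  by rewrite mn2 // m2 n1 orbT.
- move=> n2 m1; have := @phi_cf_value R m%:R (- d) n%:R _ _ _ (fun U V =>
     cf_negative_d m1 n2 dn_int dn_gt0).
  rewrite !mulNr !invrN !rmorphN !fmorphV !rmorphM /= -DE -ME -NE.
  apply; first by rewrite normrN.
  move=> i; have := @denominator_ge_half m%:R (- d) n%:R i.
  by rewrite !mulNr invrN normrN; apply; rewrite ?mn2 // n2 m1.
Qed.
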